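(* Let $K$ be a $\Delta$-$\Sigma$-field with basic set of derivations $\Delta=\{\delta_1,\dots,\delta_m\}$ and basic set of translations $\Sigma=\{\sigma_1,\dots,\sigma_h\}$, let $\Gamma$ be the free commutative semigroup of all power products $\sigma_1^{l_1}\cdots\sigma_h^{l_h}$ ($l_j\in\mathbb{N}$), and let $R=K\{y_1,\dots,y_n\}$ be the ring of $\Delta$-$\Sigma$-polynomials over $K$. Let $P$ be a prime $\Delta$-$\Sigma$-ideal of $R$ and let $P^*$ be the reflexive closure of $P$, that is, the set of all $f\in R$ such that $\gamma_f(f)\in P$ for some $\gamma_f\in\Gamma$. Then there exists $\gamma\in\Gamma$ such that $P^*=\gamma^{-1}(P)$, where $\gamma^{-1}(P)=\{f\in R\mid\gamma(f)\in P\}$.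
   Context: $\mathbb{N}$ denotes the non-negative integers. All fields have characteristic zero. A $\Delta$-$\Sigma$-ring (difference-differential ring) is a commutative ring with unity together with finite sets $\Delta=\{\delta_1,\dots,\delta_m\}$ of derivations and $\Sigma=\{\sigma_1,\dots,\sigma_h\}$ of injective ring endomorphisms (translations), such that any two of the maps in $\Delta\cup\Sigma$ commute; a $\Delta$-$\Sigma$-field is such a ring that is a field. The ring of $\Delta$-$\Sigma$-polynomials $K\{y_1,\dots,y_n\}$ is the polynomial ring over $K$ in the indeterminates $\lambda y_i$ ($1\le i\le n$), where $\lambda$ ranges over all formal power products of elements of $\Delta\cup\Sigma$ with non-negative integer exponents; it is a $\Delta$-$\Sigma$-ring with $\alpha(\lambda y_i)=(\alpha\lambda)y_i$ for $\alpha\in\Delta\cup\Sigma$ and with $\Delta\cup\Sigma$ acting on coefficients as on $K$. A $\Delta$-$\Sigma$-ideal is an ideal closed under all maps of $\Delta\cup\Sigma$; it is called prime if it is a prime ideal. *)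

(* Defs.v *)
From HB Require Import structures.
From mathcomp Require Import all_boot all_order all_algebra finmap.
From mathcomp Require Import boolp classical_sets.
From mathcomp.multinomials Require Import monalg.
From mathcomp Require Import ring.

Set Implicit Arguments.
Unset Strict Implicit.
Unset Printing Implicit Defensive.

Import GRing.Theory.

Local Open Scope ring_scope.
Local Open Scope classical_set_scope.

Definition derivation (R : comPzRingType) (d : R -> R) : Prop :=
  {morph d : x y / x + y} /\ forall x y, d (x * y) = d x * y + x * d y.

Definition ring_endomorphism (R : comPzRingType) (s : R -> R) : Prop :=
  {morph s : x y / x + y} /\ monoid_morphism s.

(* The basic sets are given as families indexed by 'I_m and 'I_h. *)
Record is_dsring (m h : nat) (R : comPzRingType)
    (delta : 'I_m -> R -> R) (sigma : 'I_h -> R -> R) : Prop := {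
  dsring_derivation : forall i, derivation (delta i);
  dsring_endomorphism : forall j, ring_endomorphism (sigma j);
  dsring_injective : forall j, injective (sigma j);
  dsring_comm_dd : forall i i' x, delta i (delta i' x) = delta i' (delta i x);
  dsring_comm_ds : forall i j x, delta i (sigma j x) = sigma j (delta i x);
  dsring_comm_ss : forall j j' x, sigma j (sigma j' x) = sigma j' (sigma j x)
}.

(* idealr_closed includes 1 \notin P, so these ideals are proper. *)
Record prime_dsideal (m h : nat) (R : comNzRingType)
    (delta : 'I_m -> R -> R) (sigma : 'I_h -> R -> R) (P : set R) : Prop := {
  dsideal_ideal : idealr_closed (mem P);
  dsideal_prime : prime_idealr_closed (mem P);
  dsideal_delta : forall i f, P f -> P (delta i f);
  dsideal_sigma : forall j f, P f -> P (sigma j f)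
}.

Notation Gamma h := {cmonom 'I_h}.

(* The factors commute in a difference-differential ring, so the order of
   composition (that of the indices) is immaterial there. *)
Definition Gamma_act (h : nat) (R : Type) (sigma : 'I_h -> R -> R)
    (g : Gamma h) : R -> R :=
  foldr (fun j F => iter (g j) (sigma j) \o F) id (enum 'I_h).

Definition reflexive_closure (h : nat) (R : Type) (sigma : 'I_h -> R -> R)
    (P : set R) : set R :=
  [set f | exists g : Gamma h, P (Gamma_act sigma g f)].

(* inl i stands for delta_i and inr j for sigma_j. *)
Definition dsop (m h : nat) : choiceType := ('I_m + 'I_h)%type.

Notation dsmonoid m h := {cmonom dsop m h}.

(* (l, k) stands for the indeterminate l y_k. *)
Definition dsvar (m h n : nat) : choiceType := (dsmonoid m h * 'I_n)%type.

Notation dsmonom m h n := {cmonom dsvar m h n}.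

Notation dspoly K m h n := {malg K[dsmonom m h n]}.

Section Operators.
Context {K : fieldType} {m h n : nat}.

Definition dsvar_shift (a : dsop m h) (v : dsvar m h n) : dsvar m h n :=
  (mmul (ucm a) v.1, v.2).

(* The multiplicative extension of v |-> a v to monomials. *)
Definition dsmonom_shift (a : dsop m h) (u : dsmonom m h n) : dsmonom m h n :=
  \big[mmul/mone]_(v <- finsupp u) expcmn (ucm (dsvar_shift a v)) (u v).

(* The Leibniz rule: a u = \sum_v u(v) (u / v) (a v), over the indeterminates
   v dividing u. *)
Definition dsmonom_deriv (a : dsop m h) (u : dsmonom m h n) : dspoly K m h n :=
  \sum_(v <- finsupp u)
     << (u v)%:R *g mmul (divcm u (ucm v)) (ucm (dsvar_shift a v)) >>.

Definition dspoly_delta (delta : 'I_m -> K -> K) (i : 'I_m)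
    (p : dspoly K m h n) : dspoly K m h n :=
  \sum_(u <- msupp p)
     (<< delta i p@_u *g u >> + p@_u *: dsmonom_deriv (inl i) u).

Definition dspoly_sigma (sigma : 'I_h -> K -> K) (j : 'I_h)
    (p : dspoly K m h n) : dspoly K m h n :=
  \sum_(u <- msupp p) << sigma j p@_u *g dsmonom_shift (inr j) u >>.

End Operators.

(* Rewriting with a pattern headed by a monomial or a term << c *g u >> may make
   unification unfold distinct monomials, which does not terminate in practice;
   hence the explicit etrans and congr2 below. *)
Section Theory.
Context {K : fieldType} {m h n : nat}.
Local Notation R := (dspoly K m h n).
Implicit Types (a : dsop m h) (u w : dsmonom m h n) (v : dsvar m h n).
Implicit Types (p q : R).

Lemma expcmnE (I : choiceType) (u : {cmonom I}) k i :
  expcmn u k i = (k * u i)%N.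
Proof.
rewrite /expcmn; case: k => [|k]; first by rewrite onecmE.
by elim: k => [|k IH] /=; rewrite ?mul1n // mulcmE [RHS]mulSn -IH.
Qed.

Lemma dsvar_shift_inj a : injective (@dsvar_shift m h n a).
Proof.
move=> [l k] [l' k'] [/= e ->]; congr (_, _).
apply/eqP/cmP => i; move/eqP/cmP: e => /(_ i).
by rewrite !cmM => /addnI.
Qed.

Lemma dsmonom_prodE (I J : choiceType) (r : seq I) (F : I -> {cmonom J}) j :
  (\big[mmul/mone]_(i <- r) F i) j = (\sum_(i <- r) F i j)%N.
Proof. by elim/big_rec2: _ => [|i k x _ <-]; rewrite ?cm1 ?cmM. Qed.

Lemma dsmonom_shiftE a u x :
  dsmonom_shift a u x = (\sum_(v <- finsupp u) u v * (dsvar_shift a v == x))%N.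
Proof.
by rewrite dsmonom_prodE; apply: eq_bigr => v _; rewrite expcmnE ucmE.
Qed.

Lemma dsmonom_shiftEw a u x (d : {fset dsvar m h n}) :
  (finsupp u `<=` d)%fset ->
  dsmonom_shift a u x = (\sum_(v <- d) u v * (dsvar_shift a v == x))%N.
Proof.
move=> sd; rewrite dsmonom_shiftE; apply: big_fset_incl => //= v _.
by rewrite -cmE_eq0 => /eqP ->.
Qed.

Lemma dsmonom_shiftM a u w :
  dsmonom_shift a (mmul u w) = mmul (dsmonom_shift a u) (dsmonom_shift a w).
Proof.
apply/eqP/cmP => v; rewrite cmM dsmonom_shiftE mdomD.
rewrite (dsmonom_shiftEw _ _ (fsubsetUl (finsupp u) (finsupp w))).
rewrite (dsmonom_shiftEw _ _ (fsubsetUr (finsupp u) (finsupp w))).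
by rewrite -big_split /=; apply: eq_bigr => x _; rewrite cmM mulnDl.
Qed.

Lemma dsmonom_shift1 a : dsmonom_shift a mone = mone :> dsmonom m h n.
Proof. by rewrite /dsmonom_shift mdom1 big_seq_fset0. Qed.

Lemma dsmonom_shift_var a v :
  dsmonom_shift a (ucm v) = ucm (dsvar_shift a v).
Proof. by rewrite /dsmonom_shift mdomU big_seq_fset1 cmUU. Qed.

Lemma dsmonom_shift_at a u v : dsmonom_shift a u (dsvar_shift a v) = u v.
Proof.
rewrite (@dsmonom_shiftEw _ _ _ (v |` finsupp u)%fset) ?fsubsetU1 //.
rewrite (big_fsetD1 v) ?fset1U1 //= eqxx muln1 big1_seq ?addn0 // => x /andP[_].
rewrite in_fsetD1 => /andP[nx _].
suff /negPf-> : dsvar_shift a x != dsvar_shift a v by rewrite muln0.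
by apply: contraNneq nx => /dsvar_shift_inj ->.
Qed.

Lemma dsmonom_shift_inj a : injective (@dsmonom_shift m h n a).
Proof.
move=> u w e; apply/eqP/cmP => v.
by rewrite -(dsmonom_shift_at a) e dsmonom_shift_at.
Qed.

Lemma malg_additive_sum (F : K -> dsmonom m h n -> R) :
  (forall u, {morph F^~ u : x y / x + y}) ->
  {morph (fun p : R => \sum_(u <- msupp p) F p@_u u) : p q / p + q} /\
  forall c u, \sum_(w <- msupp (<< c *g u >> : R)) F (<< c *g u >> : R)@_w w
              = F c u.
Proof.
move=> FD.
have F0 u : F 0 u = 0 by apply: (@addrI _ (F 0 u)); rewrite -FD !addr0.
have Fw (d : {fset dsmonom m h n}) p : (msupp p `<=` d)%fset ->
  \sum_(u <- msupp p) F p@_u u = \sum_(u <- d) F p@_u u.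
  by move=> sd; apply: big_fset_incl => //= u _ /mcoeff_outdom ->.
split=> [p q|c u]; last by rewrite (Fw _ _ msuppU_le) big_seq_fset1 mcoeffUU.
rewrite (Fw _ _ (msuppD_le p q)) (Fw _ _ (fsubsetUl (msupp p) (msupp q))).
rewrite (Fw _ _ (fsubsetUr (msupp p) (msupp q))) -big_split /=.
by apply: eq_bigr => u _; rewrite mcoeffD FD.
Qed.

Lemma dspolyMU (c d : K) u w :
  << c *g u >> * << d *g w >> = << c * d *g mmul u w >> :> R.
Proof. by rewrite malgM_def fgmulUU. Qed.

Lemma dspoly_bilinear (F G : R -> R -> R) :
  (forall p q r, F (p + q) r = F p r + F q r) ->
  (forall p q r, F r (p + q) = F r p + F r q) ->
  (forall p q r, G (p + q) r = G p r + G q r) ->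
  (forall p q r, G r (p + q) = G r p + G r q) ->
  (forall c u d w, F << c *g u >> << d *g w >> = G << c *g u >> << d *g w >>) ->
  forall p q, F p q = G p q.
Proof.
move=> FDl FDr GDl GDr FG p q.
have z (H : R -> R) : {morph H : x y / x + y} -> H 0 = 0.
  by move=> HD; apply: (@addrI _ (H 0)); rewrite -HD !addr0.
rewrite [p]monalgE; elim/big_rec: _ => [|u p' _ IH].
  by rewrite (z (F^~ q)) ?(z (G^~ q)) // => x y; rewrite ?FDl ?GDl.
rewrite FDl GDl IH {IH}; congr (_ + _).
rewrite [q]monalgE; elim/big_rec: _ => [|w q' _ IH]; last by rewrite FDr GDr IH FG.
by rewrite (z (F _)) ?(z (G _)) // => x y; rewrite ?FDr ?GDr.
Qed.

Lemma dspoly_ind (Q : R -> Prop) :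
  (forall c, Q c%:MP) -> (forall v, Q << ucm v >>) ->
  (forall p q, Q p -> Q q -> Q (p + q)) ->
  (forall p q, Q p -> Q q -> Q (p * q)) -> forall p, Q p.
Proof.
move=> QC QX QD QM p; rewrite [p]monalgE.
elim/big_rec: _ => [|u q _ Qq]; first by rewrite -malgC0E.
apply: QD => //.
rewrite -[p@_u]mulr1 -[u in << _ *g u >>]mul1m -dspolyMU.
apply: (QM) => //.
have : exists k, mdeg u = k by exists (mdeg u).
case=> k; elim: k u => [|k IH] u e; first by rewrite (mdeg_eq0I e); apply: QC.
have [v uv] : exists v, v \in finsupp u.
  apply/fset0Pn; apply/negP => /eqP e0.
  by move: e; rewrite mdegE e0 big_seq_fset0.
have eu : u = mmul (ucm v) (divcm u (ucm v)).
  apply/eqP/cmP => x; rewrite cmM divcmE ucmE subnKC //.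
  by case: eqVneq => // <-; rewrite lt0n cmE_neq0.
have ed : mdeg (divcm u (ucm v)) = k.
  by move: e; rewrite [in mdeg u]eu mdegM mdegU add1n => -[].
have -> : << u >> = << ucm v >> * << divcm u (ucm v) >> :> R.
  by rewrite dspolyMU mulr1 -eu.
by apply: (QM) => //; apply: IH.
Qed.

Lemma ucm_divcmK (I : choiceType) (u : {cmonom I}) (v : I) :
  u v != 0%N -> mmul (ucm v) (divcm u (ucm v)) = u.
Proof.
move=> uv; apply/eqP/cmP => x; rewrite cmM divcmE ucmE subnKC //.
by case: eqVneq => // <-; rewrite lt0n.
Qed.

Lemma ucmK (I : choiceType) (u : {cmonom I}) (v : I) :
  divcm (mmul (ucm v) u) (ucm v) = u.
Proof. by apply/eqP/cmP => x; rewrite divcmE cmM addKn. Qed.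

Lemma divcm_mull (I : choiceType) (u w : {cmonom I}) (v : I) :
  u v != 0%N -> divcm (mmul u w) (ucm v) = mmul (divcm u (ucm v)) w.
Proof. by move=> /ucm_divcmK {1}<-; rewrite -mulmA ucmK. Qed.

Lemma mulmAC (M : conomType) (x y z : M) :
  mmul (mmul x y) z = mmul (mmul x z) y.
Proof. by rewrite -!mulmA [mmul y z]mulmC. Qed.

Lemma divcm_mulr (I : choiceType) (u w : {cmonom I}) (v : I) :
  w v != 0%N -> divcm (mmul u w) (ucm v) = mmul u (divcm w (ucm v)).
Proof. by move=> wv; rewrite mulmC divcm_mull // mulmC. Qed.

Lemma big_leibniz (A : pzRingType) (I : Type) (r : seq I) (F G H : I -> A) x y :
  (forall i, H i = F i * y + x * G i) ->
  \sum_(i <- r) H i = (\sum_(i <- r) F i) * y + x * \sum_(i <- r) G i.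
Proof.
move=> e; rewrite mulr_suml mulr_sumr -big_split /=.
by apply: eq_bigr => i _; apply: e.
Qed.

Lemma leibniz_rearrange (A : comPzRingType) (c c' d d' u w u' w' : A) :
  (c' * u + c * u') * (d * w) + (c * u) * (d' * w + d * w') =
  (c' * d + c * d') * (u * w) + (c * d) * (u' * w + u * w').
Proof. by ring. Qed.

Lemma leibniz_addl (A : comPzRingType) (F : A -> A) (p q r : A) :
  F (p + q) = F p + F q ->
  F (p + q) * r + (p + q) * F r = (F p * r + p * F r) + (F q * r + q * F r).
Proof. by move=> ->; rewrite !mulrDl addrACA. Qed.

Lemma leibniz_addr (A : comPzRingType) (F : A -> A) (p q r : A) :
  F (p + q) = F p + F q ->
  F r * (p + q) + r * F (p + q) = (F r * p + r * F p) + (F r * q + r * F q).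
Proof. by move=> ->; rewrite !mulrDr addrACA. Qed.

Lemma dsmonom_derivM a u w :
  dsmonom_deriv a (mmul u w) =
  dsmonom_deriv a u * << w >> + << u >> * dsmonom_deriv a w :> R.
Proof.
pose T u v : R := << (u v)%:R *g mmul (divcm u (ucm v)) (ucm (dsvar_shift a v)) >>.
have Tw (d : {fset dsvar m h n}) u' : (finsupp u' `<=` d)%fset ->
  dsmonom_deriv a u' = \sum_(v <- d) T u' v.
  move=> sd; apply: big_fset_incl => //= v _.
  by rewrite -cmE_eq0 /T => /eqP ->; rewrite monalgU0.
rewrite (Tw _ _ (fsubset_refl _)) mdomD.
rewrite (Tw _ _ (fsubsetUl (finsupp u) (finsupp w))).
rewrite (Tw _ _ (fsubsetUr (finsupp u) (finsupp w))).
apply: big_leibniz => v.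
have T0 k : << 0%:R *g k >> = 0 :> R by apply: monalgU0.
have E1 : T u v * << w >> = << (u v)%:R *g mmul (divcm (mmul u w) (ucm v))
                                   (ucm (dsvar_shift a v)) >>.
  apply: etrans (dspolyMU _ _ _ _) _; rewrite mulr1.
  have [->|uv] := eqVneq (u v) 0%N.
    exact: etrans (T0 _) (esym (T0 _)).
  apply: (congr1 (mkmalgU^~ _)); apply: esym.
  apply: etrans (mulmAC _ _ _).
  exact: (congr1 (mmul^~ _) (divcm_mull _ uv)).
have E2 : << u >> * T w v = << (w v)%:R *g mmul (divcm (mmul u w) (ucm v))
                                   (ucm (dsvar_shift a v)) >>.
  apply: etrans (dspolyMU _ _ _ _) _; rewrite mul1r.
  have [->|wv] := eqVneq (w v) 0%N.
    exact: etrans (T0 _) (esym (T0 _)).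
  apply: (congr1 (mkmalgU^~ _)); apply: esym.
  apply: etrans (esym (mulmA _ _ _)).
  exact: (congr1 (mmul^~ _) (divcm_mulr _ wv)).
apply: etrans (congr2 +%R (esym E1) (esym E2)).
apply: etrans (monalgUD _ _ _); apply: (congr1 (mkmalgU _)).
exact: etrans (congr1 (fun k => k%:R) (cmM _ _ _)) (natrD _ _ _).
Qed.

Lemma dsmonom_deriv1 a : dsmonom_deriv a mone = 0 :> R.
Proof. by rewrite /dsmonom_deriv mdom1 big_seq_fset0. Qed.

Lemma dsmonom_deriv_var a v :
  dsmonom_deriv a (ucm v) = << ucm (dsvar_shift a v) >> :> R.
Proof.
rewrite /dsmonom_deriv mdomU big_seq_fset1 cmUU; apply: (congr1 (mkmalgU^~ _)).
have -> : divcm (ucm v) (ucm v) = mone.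
  by apply/eqP/cmP => x; rewrite divcmE subnn cm1.
exact: mul1m.
Qed.

Context (delta : 'I_m -> K -> K) (sigma : 'I_h -> K -> K).
Context (dsK : is_dsring delta sigma).
Local Notation D := (dspoly_delta delta : 'I_m -> R -> R).
Local Notation S := (dspoly_sigma sigma : 'I_h -> R -> R).

Lemma dspoly_sigmaU j c u :
  S j << c *g u >> = << sigma j c *g dsmonom_shift (inr j) u >>.
Proof.
apply: (proj2 (malg_additive_sum
  (F := fun c u => << sigma j c *g dsmonom_shift (inr j) u >>) _)).
by move=> w x y /=; rewrite (dsring_endomorphism dsK j).1 monalgUD.
Qed.

Lemma dspoly_sigmaD j : {morph S j : p q / p + q}.
Proof.
apply: (proj1 (malg_additive_sum
  (F := fun c u => << sigma j c *g dsmonom_shift (inr j) u >>) _)).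
by move=> w x y /=; rewrite (dsring_endomorphism dsK j).1 monalgUD.
Qed.

Lemma dspoly_sigmaM j : {morph S j : p q / p * q}.
Proof.
move=> p q; pose F p q := S j (p * q); pose G p q := S j p * S j q.
apply: (dspoly_bilinear (F := F) (G := G)); rewrite /F /G {F G p q}.
- by move=> p q r; rewrite mulrDl dspoly_sigmaD.
- by move=> p q r; rewrite mulrDr dspoly_sigmaD.
- by move=> p q r; rewrite dspoly_sigmaD mulrDl.
- by move=> p q r; rewrite dspoly_sigmaD mulrDr.
move=> c u d w.
apply: etrans (congr1 (S j) (dspolyMU c d u w)) _.
apply: etrans (dspoly_sigmaU _ _ _) _; apply: esym.
apply: etrans (congr2 *%R (dspoly_sigmaU _ _ _) (dspoly_sigmaU _ _ _)) _.
apply: etrans (dspolyMU _ _ _ _) _; apply: esym.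
by rewrite (dsring_endomorphism dsK j).2.2 dsmonom_shiftM.
Qed.

Lemma dspoly_sigmaC j c : S j c%:MP = (sigma j c)%:MP.
Proof. by rewrite dspoly_sigmaU dsmonom_shift1. Qed.

Lemma dspoly_sigma_var j v :
  S j << ucm v >> = << ucm (dsvar_shift (inr j) v) >>.
Proof.
by rewrite dspoly_sigmaU dsmonom_shift_var (dsring_endomorphism dsK j).2.1.
Qed.

Lemma dspoly_sigma_at j p u : (S j p)@_(dsmonom_shift (inr j) u) = sigma j p@_u.
Proof.
have s0 : sigma j 0 = 0.
  by apply: (@addrI _ (sigma j 0)); rewrite -(dsring_endomorphism dsK j).1 !addr0.
have S0 : S j 0 = 0 by apply: (@addrI _ (S j 0)); rewrite -dspoly_sigmaD !addr0.
rewrite [p]monalgE; elim/big_rec: _ => [|w q _ IH].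
  by rewrite S0 !mcoeff0 s0.
apply: etrans (congr1 (mcoeff _) (dspoly_sigmaD _ _ _)) _.
apply: etrans (mcoeffD _ _ _) _; apply: esym.
apply: etrans (congr1 (sigma j) (mcoeffD _ _ _)) _.
apply: etrans ((dsring_endomorphism dsK j).1 _ _) _.
apply: (congr2 +%R _ (esym IH)); apply: esym.
apply: etrans (congr1 (mcoeff _) (dspoly_sigmaU _ _ _)) _.
apply: etrans (mcoeffU _ _ _) _; rewrite (inj_eq (@dsmonom_shift_inj _)) mcoeffU.
by case: (w == u); rewrite ?mulr1n ?mulr0n ?s0.
Qed.

Lemma dspoly_sigma_inj j : injective (S j).
Proof.
move=> p q e; apply/malgP => u; apply: (dsring_injective dsK (j := j)).
by rewrite -!dspoly_sigma_at e.
Qed.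

Let Dt i c u : R := << delta i c *g u >> + c *: dsmonom_deriv (inl i) u.

Let DtD i u : {morph Dt i ^~ u : x y / x + y}.
Proof.
move=> x y; rewrite /Dt (dsring_derivation dsK i).1 monalgUD scalerDl.
exact: addrACA.
Qed.

Lemma dspoly_deltaU i c u :
  D i << c *g u >> = << delta i c *g u >> + c *: dsmonom_deriv (inl i) u.
Proof. exact: (proj2 (malg_additive_sum (DtD i))). Qed.

Lemma dspoly_deltaD i : {morph D i : p q / p + q}.
Proof. exact: (proj1 (malg_additive_sum (DtD i))). Qed.

Lemma dspoly_deltaM i p q : D i (p * q) = D i p * q + p * D i q.
Proof.
pose F p q := D i (p * q); pose G p q := D i p * q + p * D i q.
apply: (dspoly_bilinear (F := F) (G := G)); rewrite /F /G {F G p q}.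
- by move=> p q r; rewrite mulrDl dspoly_deltaD.
- by move=> p q r; rewrite mulrDr dspoly_deltaD.
- move=> p q r; exact: (leibniz_addl r (dspoly_deltaD i p q)).
- move=> p q r; exact: (leibniz_addr r (dspoly_deltaD i p q)).
move=> c u d w.
have e b x : << b *g x >> = b%:MP * << x >> :> R.
  by rewrite dspolyMU mulr1 mul1m.
have CM : {morph (fun b => b%:MP : R) : b1 b2 / b1 * b2}.
  by move=> b1 b2; apply: rmorphM.
have eD b x :
    D i << b *g x >> = (delta i b)%:MP * << x >> + b%:MP * dsmonom_deriv (inl i) x.
  apply: etrans (dspoly_deltaU _ _ _) _.
  apply: (congr2 +%R (e _ _)); apply: esym; exact: mul_malgC.
apply: etrans (congr1 (D i) (dspolyMU c d u w)) _.
apply: etrans (eD _ _) _; apply: esym.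
apply: etrans (congr2 +%R (congr2 *%R (eD _ _) (e _ _))
                          (congr2 *%R (e _ _) (eD _ _))) _.
apply: etrans (leibniz_rearrange _ _ _ _ _ _ _ _) _; apply: esym.
apply: (congr2 +%R (congr2 *%R _ _) (congr2 *%R _ _)).
- rewrite (dsring_derivation dsK i).2; apply: etrans (monalgUD _ _ _) _.
  exact: (congr2 +%R (CM _ _) (CM _ _)).
- by apply: esym; apply: etrans (dspolyMU _ _ _ _) _; rewrite mulr1.
- exact: CM.
- exact: dsmonom_derivM.
Qed.

Lemma dsring_delta1 i : delta i 1 = 0.
Proof.
have := (dsring_derivation dsK i).2 1 1.
by rewrite !mulr1 mul1r => /esym/(canRL (addrK _)); rewrite subrr.
Qed.

Lemma dspoly_deltaC i c : D i c%:MP = (delta i c)%:MP.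
Proof. by rewrite dspoly_deltaU dsmonom_deriv1 scaler0 addr0. Qed.

Lemma dspoly_delta_var i v :
  D i << ucm v >> = << ucm (dsvar_shift (inl i) v) >>.
Proof.
apply: etrans (dspoly_deltaU _ _ _) _.
have z : << delta i 1 *g ucm v >> = 0 :> R by rewrite dsring_delta1 monalgU0.
apply: etrans (congr2 +%R z erefl) _; apply: etrans (add0r _) _; apply: etrans (scale1r _) _.
exact: dsmonom_deriv_var.
Qed.

Lemma dsvar_shiftC a b v :
  dsvar_shift a (dsvar_shift b v) = dsvar_shift b (dsvar_shift a v).
Proof. by rewrite /dsvar_shift /= !mulmA (mulmC (ucm a)). Qed.

Lemma comm_at (T : Type) (F G : T -> T) (x y y' z z' : T) :
  G x = y -> F y = z -> F x = y' -> G y' = z' -> z = z' -> F (G x) = G (F x).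
Proof. by move=> -> -> -> -> ->. Qed.

Lemma comm_add (A : comPzRingType) (F G : A -> A) (p q : A) :
  {morph F : x y / x + y} -> {morph G : x y / x + y} ->
  F (G p) = G (F p) -> F (G q) = G (F q) -> F (G (p + q)) = G (F (p + q)).
Proof. by move=> FD GD ep eq; rewrite GD !FD GD ep eq. Qed.

Lemma comm_der_der (A : comPzRingType) (F G : A -> A) (p q : A) :
  {morph F : x y / x + y} -> (forall x y, F (x * y) = F x * y + x * F y) ->
  {morph G : x y / x + y} -> (forall x y, G (x * y) = G x * y + x * G y) ->
  F (G p) = G (F p) -> F (G q) = G (F q) -> F (G (p * q)) = G (F (p * q)).
Proof.
move=> FD FM GD GM ep eq.
by rewrite GM FD !FM GD !GM ep eq addrACA.
Qed.

Lemma comm_der_end (A : comPzRingType) (F G : A -> A) (p q : A) :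
  (forall x y, F (x * y) = F x * y + x * F y) ->
  {morph G : x y / x + y} -> {morph G : x y / x * y} ->
  F (G p) = G (F p) -> F (G q) = G (F q) -> F (G (p * q)) = G (F (p * q)).
Proof. by move=> FM GD GM ep eq; rewrite GM !FM GD !GM ep eq. Qed.

Lemma comm_end_end (A : comPzRingType) (F G : A -> A) (p q : A) :
  {morph F : x y / x * y} -> {morph G : x y / x * y} ->
  F (G p) = G (F p) -> F (G q) = G (F q) -> F (G (p * q)) = G (F (p * q)).
Proof. by move=> FM GM ep eq; rewrite GM !FM GM ep eq. Qed.

Lemma dspoly_is_dsring : is_dsring D S.
Proof.
split.
- by move=> i; split; [apply: dspoly_deltaD|apply: dspoly_deltaM].
- move=> j; split; first exact: dspoly_sigmaD.
  split; last exact: dspoly_sigmaM.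
  by rewrite /= dspoly_sigmaC (dsring_endomorphism dsK j).2.1.
- exact: dspoly_sigma_inj.
- move=> i i'; apply: dspoly_ind => [c|v|p q ep eq|p q ep eq].
  + exact: comm_at (dspoly_deltaC _ _) (dspoly_deltaC _ _)
      (dspoly_deltaC _ _) (dspoly_deltaC _ _)
      (congr1 malgC (dsring_comm_dd dsK _ _ _)).
  + exact: comm_at (dspoly_delta_var _ _) (dspoly_delta_var _ _)
      (dspoly_delta_var _ _) (dspoly_delta_var _ _)
      (congr1 (fun x => << ucm x >>) (dsvar_shiftC _ _ _)).
  + exact: comm_add (dspoly_deltaD i) (dspoly_deltaD i') ep eq.
  + exact: comm_der_der (dspoly_deltaD i) (dspoly_deltaM i)
      (dspoly_deltaD i') (dspoly_deltaM i') ep eq.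
- move=> i j; apply: dspoly_ind => [c|v|p q ep eq|p q ep eq].
  + exact: comm_at (dspoly_sigmaC _ _) (dspoly_deltaC _ _)
      (dspoly_deltaC _ _) (dspoly_sigmaC _ _)
      (congr1 malgC (dsring_comm_ds dsK _ _ _)).
  + exact: comm_at (dspoly_sigma_var _ _) (dspoly_delta_var _ _)
      (dspoly_delta_var _ _) (dspoly_sigma_var _ _)
      (congr1 (fun x => << ucm x >>) (dsvar_shiftC _ _ _)).
  + exact: comm_add (dspoly_deltaD i) (dspoly_sigmaD j) ep eq.
  + exact: comm_der_end (dspoly_deltaM i)
      (dspoly_sigmaD j) (dspoly_sigmaM j) ep eq.
- move=> j j'; apply: dspoly_ind => [c|v|p q ep eq|p q ep eq].
  + exact: comm_at (dspoly_sigmaC _ _) (dspoly_sigmaC _ _)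
      (dspoly_sigmaC _ _) (dspoly_sigmaC _ _)
      (congr1 malgC (dsring_comm_ss dsK _ _ _)).
  + exact: comm_at (dspoly_sigma_var _ _) (dspoly_sigma_var _ _)
      (dspoly_sigma_var _ _) (dspoly_sigma_var _ _)
      (congr1 (fun x => << ucm x >>) (dsvar_shiftC _ _ _)).
  + exact: comm_add (dspoly_sigmaD j) (dspoly_sigmaD j') ep eq.
  + exact: comm_end_end (dspoly_sigmaM j) (dspoly_sigmaM j') ep eq.
Qed.

End Theory.

(* Main.v *)
(** The sets g^-1(P) are prime difference-differential ideals whose directed
    union is P*, so it suffices to capture P* by finitely many of its
    elements. Order the indeterminates l y_i by a well-ordering compatible
    with the operators, and record the pairs (v, k) such that P* contains a
    polynomial of degree k in v over the smaller indeterminates whose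
    initial and separant lie outside P*. By Dickson's lemma there are
    finitely many recorded pairs such that every recorded (v, k) has w | v
    and l <= k for one of these pairs (w, l); choose g so that Q = g^-1(P)
    contains the corresponding polynomials. Since P* is reflexive, applying
    a translation to such a polynomial leaves initial and separant outside
    P*, and applying a derivation yields degree 1 with the separant as
    initial. Hence Q contains, for every f in P* with initial outside P*, a
    polynomial of the same leader and degree with initial outside P*, and
    pseudo-division by it shows by induction that f is in Q. *)

Require Import Defs.
From HB Require Import structures.
From mathcomp Require Import all_boot all_order all_algebra finmap.
From mathcomp Require Import boolp classical_sets.
From mathcomp.multinomials Require Import monalg.
From mathcomp Require Import ring.

Set Implicit Arguments.
Unset Strict Implicit.
Unset Printing Implicit Defensive.

Import GRing.Theory.

Local Open Scope ring_scope.
Local Open Scope classical_set_scope.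

(** * Dickson's lemma for families of natural-number coordinates *)

Lemma dickson (T : Type) (I : finType) (c : I -> T -> nat) (S : T -> Prop) :
  exists F : seq T, List.Forall S F /\
    forall x, S x -> List.Exists (fun y => forall i, (c i y <= c i x)%N) F.
Proof.
suff [F [FS F_le]] : exists F : seq T, List.Forall S F /\ forall x, S x ->
    List.Exists (fun y => {in enum I, forall i, (c i y <= c i x)%N}) F.
  exists F; split=> // x /F_le; apply: List.Exists_impl => y le i.
  by apply: le; rewrite mem_enum.
elim: (enum I) S => [|i s IH] S.
  have [[x Sx]|nS] := pselect (exists x, S x).
    exists [:: x]; split; first by constructor.
    by move=> y _; constructor.
  by exists [::]; split=> // x Sx; case: nS; exists x.
have [F0 [F0S F0_le]] := IH S.
(* Below any bound [k] on coordinate [i], one finite set per exact value of that coordinate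
   suffices, since within such a slice only the coordinates in [s] matter. *)
have slice k : exists F, List.Forall S F /\ forall x, S x -> (c i x < k)%N ->
    List.Exists (fun y => {in i :: s, forall i, (c i y <= c i x)%N}) F.
  elim: k => [|k [F [FS F_le]]]; first by exists [::].
  have [F' [F'S F'_le]] := IH (fun x => S x /\ c i x = k).
  exists (F ++ F'); split.
    by apply/List.Forall_app; split=> //; apply: List.Forall_impl F'S => x [].
  move=> x Sx; rewrite ltnS leq_eqVlt => /predU1P[xk|/(F_le x Sx) Fx]; last first.
    by apply/List.Exists_app; left.
  apply/List.Exists_app; right.
  have /List.Exists_exists[y [yF' le]] := F'_le x (conj Sx xk).
  apply/List.Exists_exists; exists y; split=> // j; rewrite inE => /predU1P[->|/le //].
  by rewrite xk; have [_ ->] := (List.Forall_forall _ _).1 F'S y yF'.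
(* The bound is at least [c i y] for every [y] in [F0]: an [x] at or above it dominates in
   coordinate [i] whichever element of [F0] it dominates along [s]. *)
have [F [FS F_le]] := slice (\sum_(y <- F0) c i y)%N.
exists (F ++ F0); split; first exact/List.Forall_app.
move=> x Sx; apply/List.Exists_app.
have [/(F_le x Sx)|le] := ltnP (c i x) (\sum_(y <- F0) c i y)%N; first by left.
right; move: le (F0_le x Sx); clear.
elim: F0 => [_ /List.Exists_nil //|y F0 IHF].
rewrite big_cons => le /List.Exists_cons[yx|F0x].
  apply: List.Exists_cons_hd => j; rewrite inE => /predU1P[->|/yx //].
  exact: leq_trans (leq_addr _ _) le.
by apply: List.Exists_cons_tl; apply: IHF => //; apply: leq_trans (leq_addl _ _) le.
Qed.

(** * Lexicographic comparison of coordinates *)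

Section LexicographicOrder.
Context {T : Type} {I : eqType} (c : I -> T -> nat).
Implicit Types (s : seq I) (x y z : T).

Fixpoint lexlt s x y : bool :=
  if s is i :: s' then
    (c i x < c i y)%N || (c i x == c i y) && lexlt s' x y
  else false.

Lemma lexlt_trans s y x z : lexlt s x y -> lexlt s y z -> lexlt s x z.
Proof.
elim: s => //= i s IH /orP[xy|/andP[/eqP exy xy]] /orP[yz|/andP[/eqP eyz yz]].
- by rewrite (ltn_trans xy yz).
- by rewrite -eyz xy.
- by rewrite exy yz.
- by rewrite exy eyz eqxx IH ?orbT.
Qed.

Lemma lexlt_wf s : well_founded (fun x y => lexlt s x y).
Proof.
elim: s => [|i s IH] x; first by constructor.
(* The outer induction bounds the head coordinate; the inner one follows the order on the tail while
   the head stays fixed. *)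
have [k] := ubnP (c i x); elim: k x => [x|k IHk x]; first by rewrite ltn0.
rewrite ltnS.
elim: (IH x) => {}x _ IHx xk; constructor=> y /= /orP[lt|/andP[/eqP e lt]].
  exact: IHk (leq_trans lt xk).
by apply: (IHx _ lt); rewrite e.
Qed.

Lemma lexlt_total s x y :
  [\/ lexlt s x y, lexlt s y x | {in s, forall i, c i x = c i y}].
Proof.
elim: s => [|i s IH] /=; first by constructor 3.
case: ltngtP => [_|_|e] /=; [by constructor 1 | by constructor 2 |].
case: IH => [xy|yx|exy]; [by constructor 1 | by constructor 2 |].
by constructor 3 => j; rewrite inE => /predU1P[->|/exy].
Qed.

Lemma lexlt_shift s (f : T -> T) (d : I -> nat) x y :
  (forall i z, c i (f z) = d i + c i z)%N -> lexlt s x y -> lexlt s (f x) (f y).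
Proof.
by move=> fE; elim: s => //= i s IH; rewrite !fE ltn_add2l eqn_add2l
  => /orP[->//|/andP[-> /IH ->]]; rewrite orbT.
Qed.

Lemma lexlt_incr s i x y : (forall j, c j x <= c j y)%N ->
  i \in s -> (c i x < c i y)%N -> lexlt s x y.
Proof.
move=> le; elim: s => //= j s IH; rewrite inE => /predU1P[-> ->//|/IH{}IH /IH ->].
by rewrite andbT orbC -leq_eqVlt le.
Qed.

End LexicographicOrder.

(** * A ranking of the indeterminates compatible with the operators *)

Section Ranking.
Context {m h n : nat}.
Local Notation V := (dsvar m h n).
Implicit Types (a : dsop m h) (v w : V).

(** The index of [y_k] is one more coordinate, so that the coordinates determine the indeterminate
    and comparing them gives a total order. *)
Definition dsvar_coord (i : option ('I_m + 'I_h)) v : nat :=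
  if i is Some a then v.1 a else v.2.

Lemma dsvar_coord_inj v w :
  (forall i, dsvar_coord i v = dsvar_coord i w) -> v = w.
Proof.
case: v w => l k [l' k'] e; congr (_, _); last by apply: val_inj; apply: (e None).
by apply/eqP/cmP => a; apply: (e (Some a)).
Qed.

Definition dsvar_lt : rel V :=
  lexlt dsvar_coord (enum {: option ('I_m + 'I_h)}).

Lemma dsvar_coord_shift a i v : dsvar_coord i (dsvar_shift a v) =
  ((Some a == i) + dsvar_coord i v)%N.
Proof. by case: i => [b|] //=; rewrite cmM ucmE. Qed.

Lemma dsvar_lt_trans w v v' : dsvar_lt v w -> dsvar_lt w v' -> dsvar_lt v v'.
Proof. exact: lexlt_trans. Qed.

Lemma dsvar_lt_wf : well_founded dsvar_lt.
Proof. exact: lexlt_wf. Qed.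

Lemma dsvar_lt_total v w : [\/ dsvar_lt v w, dsvar_lt w v | v = w].
Proof.
have [vw|wv|e] := lexlt_total dsvar_coord (enum {: option ('I_m + 'I_h)}) v w.
- by constructor 1.
- by constructor 2.
by constructor 3; apply: dsvar_coord_inj => i; apply: e; rewrite mem_enum.
Qed.

Lemma dsvar_lt_shift a v w :
  dsvar_lt v w -> dsvar_lt (dsvar_shift a v) (dsvar_shift a w).
Proof. by apply: lexlt_shift => i z; apply: dsvar_coord_shift. Qed.

Lemma dsvar_lt_shiftr a v : dsvar_lt v (dsvar_shift a v).
Proof.
apply: (@lexlt_incr _ _ _ _ (Some a)) => [i||].
- by rewrite dsvar_coord_shift leq_addl.
- by rewrite mem_enum.
- by rewrite dsvar_coord_shift eqxx.
Qed.

(** Every multiple of [w] is reached from [w] by finitely many operators: as long as some exponent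
    of [v] exceeds that of [w], one operator can be stripped from [v], which lowers its degree. *)
Lemma dsvar_shift_ind (Q : V -> Prop) (w v : V) :
  (forall a u, Q u -> Q (dsvar_shift a u)) ->
  w.2 = v.2 -> (forall a, w.1 a <= v.1 a)%N -> Q w -> Q v.
Proof.
move=> Qshift e2 le Qw.
have [k] := ubnP (mdeg v.1); elim: k v e2 le => // k IH [l i] /= e2 le lt.
have [[a a_lt]|ge] := pselect (exists a, w.1 a < l a)%N.
  have la : l a != 0%N by rewrite -lt0n; apply: leq_ltn_trans a_lt.
  have -> : (l, i) = dsvar_shift a (divcm l (ucm a), i).
    by rewrite /dsvar_shift /= ucm_divcmK.
  apply: (Qshift); apply: IH => //= [b|].
    rewrite divcmE ucmE; case: eqVneq => [<-|_]; last by rewrite subn0.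
    by rewrite subn1 -ltnS prednK // lt0n.
  by move: lt; rewrite -[in mdeg l](ucm_divcmK la) mdegM mdegU.
suff <- : w = (l, i) by [].
case: w e2 le ge {IH Qw} => l' i' /= -> le ge; congr (_, _).
apply/eqP/cmP => a; apply/eqP; rewrite eqn_leq le leqNgt /=.
by apply/negP => lt'; apply: ge; exists a.
Qed.

End Ranking.

(** * Elementary closure properties of prime difference-differential ideals *)

Section PrimeDsIdeal.
Context {m h : nat} {R : comNzRingType}.
Context {D : 'I_m -> R -> R} {S : 'I_h -> R -> R} {P : set R}.

Lemma prime_dsidealP : prime_dsideal D S P <->
  [/\ P 0, ~ P 1, forall a x y, P x -> P y -> P (a * x + y),
      forall x y, P (x * y) -> P x \/ P y &
      (forall i x, P x -> P (D i x)) /\ (forall j x, P x -> P (S j x))].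
Proof.
have inP x : x \in mem P = (x \in P) by [].
split=> [[[P0 P1 PD] Pp Pd Ps]|[P0 P1 PD Pp [Pd Ps]]].
  split=> //.
  - by move: P0; rewrite inP inE.
  - by move=> P1'; move/negP: P1; apply; rewrite inP inE.
  - move=> a x y Px Py; have := PD a x y; rewrite !inP !inE; exact.
  - move=> x y Pxy; have := Pp x y; rewrite !inP !inE => /(_ Pxy) /orP[];
      by rewrite inE; tauto.
split=> //.
  split.
  - by rewrite inP inE.
  - by apply/negP; rewrite inP inE.
  - by move=> a x y; rewrite !inP !inE; apply: PD.
by move=> x y; rewrite !inP !inE => /Pp[Px|Py]; apply/orP; [left|right]; rewrite inE.
Qed.

Hypothesis pP : prime_dsideal D S P.

Lemma dsideal0 : P 0. Proof. by case/prime_dsidealP: pP. Qed.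

Lemma dsideal1 : ~ P 1. Proof. by case/prime_dsidealP: pP. Qed.

Lemma dsidealM a x : P x -> P (a * x).
Proof.
move=> Px; case/prime_dsidealP: pP => P0 _ PD _ _.
by rewrite -[_ * _]addr0; apply: PD.
Qed.

Lemma dsidealD x y : P x -> P y -> P (x + y).
Proof. by case/prime_dsidealP: pP => _ _ PD _ _ Px Py; rewrite -[x]mul1r; apply: PD. Qed.

Lemma dsidealB x y : P x -> P y -> P (x - y).
Proof. by move=> Px Py; rewrite -mulN1r; apply: dsidealD => //; apply: dsidealM. Qed.

Lemma dsideal_prime_or x y : P (x * y) -> P x \/ P y.
Proof. by case/prime_dsidealP: pP => _ _ _ Pp _; apply: Pp. Qed.

End PrimeDsIdeal.

(** * The action of the semigroup of translations *)

Section GammaAction.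
Context {h : nat} {T : Type} {S : 'I_h -> T -> T}.
Hypothesis SC : forall i j x, S i (S j x) = S j (S i x).
Implicit Types (g : Gamma h) (s : seq 'I_h).

Local Notation act s g := (foldr (fun j F => iter (g j) (S j) \o F) id s).

Lemma iter_comm (F G : T -> T) k x :
  (forall y, F (G y) = G (F y)) -> F (iter k G x) = iter k G (F x).
Proof. by move=> FG; elim: k => //= k <-. Qed.

Lemma Gamma_act_comm (F : T -> T) g x :
  (forall j y, F (S j y) = S j (F y)) -> F (Gamma_act S g x) = Gamma_act S g (F x).
Proof.
move=> FS; rewrite /Gamma_act; elim: (enum _) => //= j s <-.
exact: iter_comm.
Qed.

Lemma Gamma_actM g g' x :
  Gamma_act S (mmul g g') x = Gamma_act S g (Gamma_act S g' x).
Proof.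
have actC s g1 j k y : iter k (S j) (act s g1 y) = act s g1 (iter k (S j) y).
  elim: s => //= i s <-; apply: iter_comm => z.
  by apply: esym; apply: iter_comm => z'.
rewrite /Gamma_act; elim: (enum _) => //= j s ->.
by rewrite cmM iterD; congr iter; rewrite actC.
Qed.

Lemma Gamma_actU j x : Gamma_act S (ucm j) x = S j x.
Proof.
rewrite /Gamma_act.
suff -> s : uniq s -> act s (ucm j) x = if j \in s then S j x else x.
  by rewrite mem_enum.
  exact: enum_uniq.
elim: s => //= i s IH /andP[nis us]; rewrite (IH us) inE ucmE.
by have [->|ij] := eqVneq j i; rewrite ?(negPf nis).
Qed.

Lemma Gamma_act_closed (P : set T) g x :
  (forall j y, P y -> P (S j y)) -> P x -> P (Gamma_act S g x).
Proof.
move=> PS Px; rewrite /Gamma_act; elim: (enum _) => //= j s IH.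
by elim: (g j) => //= k; apply: PS.
Qed.

End GammaAction.

(** * Preimages of [P] and their directed union *)

Section ReflexiveClosure.
Context {m h : nat} {R : comNzRingType}.
Context {D : 'I_m -> R -> R} {S : 'I_h -> R -> R}.
Hypothesis dsR : is_dsring D S.
Implicit Types (g : Gamma h) (x y : R).

Let SC i j x : S i (S j x) = S j (S i x). Proof. exact: dsring_comm_ss dsR i j x. Qed.

Lemma dsring_delta0 i : D i 0 = 0.
Proof. by apply: (@addrI _ (D i 0)); rewrite -(dsring_derivation dsR i).1 !addr0. Qed.

Lemma Gamma_act_endomorphism g : ring_endomorphism (Gamma_act S g).
Proof.
rewrite /Gamma_act; elim: (enum _) => [|j s [FD [F1 FM]]]; first by split.
have [SD [S1 SM]] : ring_endomorphism (iter (g j) (S j)).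
  elim: (g j) => [|k [SD [S1 SM]]]; first by split.
  have [SjD [Sj1 SjM]] := dsring_endomorphism dsR j.
  split; first by move=> x y; rewrite iterS SD SjD.
  by split; [rewrite iterS S1|move=> x y; rewrite iterS SM SjM].
split; first by move=> x y; rewrite /= FD SD.
by split; [rewrite /= F1|move=> x y; rewrite /= FM SM].
Qed.

Lemma Gamma_act0 g : Gamma_act S g 0 = 0.
Proof.
have [aD _] := Gamma_act_endomorphism g.
by apply: (@addrI _ (Gamma_act S g 0)); rewrite -aD !addr0.
Qed.

Context {P : set R}.
Hypothesis pP : prime_dsideal D S P.

Lemma Gamma_act_absorb g x : P x -> P (Gamma_act S g x).
Proof. exact: Gamma_act_closed (dsideal_sigma pP). Qed.

(** The action of [g] is a ring endomorphism, which pulls primes back to primes, and it commutes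
    with every operator. *)
Lemma preimage_prime_dsideal g : prime_dsideal D S (Gamma_act S g @^-1` P).
Proof.
have [aD [a1 aM]] := Gamma_act_endomorphism g.
apply/prime_dsidealP; rewrite /preimage; split=> /=.
- by rewrite Gamma_act0; apply: dsideal0 pP.
- by rewrite a1; apply: dsideal1 pP.
- by move=> a x y Px Py; rewrite aD aM; apply: (dsidealD pP) => //; apply: (dsidealM pP).
- by move=> x y; rewrite aM; apply: (dsideal_prime_or pP).
split=> [i|j] x Px.
  rewrite -(@Gamma_act_comm _ _ _ (D i)) => [|j y]; last exact: (dsring_comm_ds dsR).
  exact: (dsideal_delta pP).
rewrite -(@Gamma_act_comm _ _ _ (S j)) => [|i y]; last exact: SC.
exact: (dsideal_sigma pP).
Qed.

(** This is the directedness of the union: the product of the two power products serves both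
    elements, because [P] is closed under translations. *)
Lemma reflexive_closure_pair x y :
  reflexive_closure S P x -> reflexive_closure S P y ->
  exists g, P (Gamma_act S g x) /\ P (Gamma_act S g y).
Proof.
move=> [g gx] [g' gy]; exists (mmul g g'); split; last first.
  by rewrite (Gamma_actM SC); apply: Gamma_act_absorb.
by rewrite mulmC (Gamma_actM SC); apply: Gamma_act_absorb.
Qed.

Lemma reflexive_closure_prime_dsideal : prime_dsideal D S (reflexive_closure S P).
Proof.
have pre g := preimage_prime_dsideal g.
apply/prime_dsidealP; split.
- by exists mone; apply: dsideal0 (pre _).
- by case=> g; apply: dsideal1 (pre g).
- move=> a x y /reflexive_closure_pair /[apply] -[g [gx gy]].
  by exists g; apply: (dsidealD (pre g)) => //; apply: (dsidealM (pre g)).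
- by move=> x y [g] /(dsideal_prime_or (pre g))[gx|gy]; [left|right]; exists g.
split=> [i|j] x [g gx]; exists g.
  exact: (dsideal_delta (pre g)).
exact: (dsideal_sigma (pre g)).
Qed.

Lemma reflexive_closure_sigma j x :
  reflexive_closure S P (S j x) -> reflexive_closure S P x.
Proof. by move=> [g gx]; exists (mmul g (ucm j)); rewrite (Gamma_actM SC) Gamma_actU. Qed.

Lemma reflexive_closure_finite (F : seq R) :
  List.Forall (reflexive_closure S P) F ->
  exists g, List.Forall (Gamma_act S g @^-1` P) F.
Proof.
elim: F => [|x F IH] FP; first by exists mone.
have [xP {}FP] := (List.Forall_cons_iff _ _ _).1 FP; case: xP => g gx.
have [g' g'F] := IH FP; exists (mmul g g'); constructor.
  by rewrite /preimage /= mulmC (Gamma_actM SC); apply: Gamma_act_absorb.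
apply: List.Forall_impl g'F => y g'y.
by rewrite /preimage /= (Gamma_actM SC); apply: Gamma_act_absorb.
Qed.

End ReflexiveClosure.

(** * Operators applied to values of univariate polynomials *)

Lemma ring_endomorphism_rmorphism (R : comNzRingType) (s : R -> R) :
  ring_endomorphism s -> exists f : {rmorphism R -> R}, s = f.
Proof.
move=> [sD sM].
have s0 : s 0 = 0 by apply: (@addrI _ (s 0)); rewrite -sD !addr0.
pose f : {rmorphism R -> R} := HB.pack s
  (GRing.isNmodMorphism.Build R R s (s0, sD)) (GRing.isMonoidMorphism.Build R R s sM).
by exists f.
Qed.

(** The chain rule, with a first term for the coefficients of [q] and a second one for the
    argument. *)
Lemma derivation_horner (R : comNzRingType) (d : R -> R) (q : {poly R}) x :
  derivation d -> d q.[x] = (map_poly d q).[x] + q^`().[x] * d x.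
Proof.
move=> [dD dM].
have d0 : d 0 = 0 by apply: (@addrI _ (d 0)); rewrite -dD !addr0.
elim/poly_ind: q => [|q c IH]; first by rewrite map_poly0 deriv0 !horner0 d0 mul0r addr0.
have -> : map_poly d (q * 'X + c%:P) = map_poly d q * 'X + (d c)%:P.
  apply/polyP => i; rewrite coef_map_id0 // !coefD !coefMX !coefC dD.
  by case: i => [|i] /=; rewrite ?d0 // coef_map_id0.
by rewrite derivMXaddC !hornerE dD dM IH; ring.
Qed.

(** * Rings generated by constants and ranked indeterminates *)

Section Generated.
Context {K : fieldType} {m h n : nat} {R : comNzRingType}.
Context (delta : 'I_m -> K -> K) (sigma : 'I_h -> K -> K).
Context (D : 'I_m -> R -> R) (S : 'I_h -> R -> R).
Context (cst : {rmorphism K -> R}) (X : dsvar m h n -> R).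
Hypothesis dsR : is_dsring D S.
Hypothesis D_cst : forall i c, D i (cst c) = cst (delta i c).
Hypothesis S_cst : forall j c, S j (cst c) = cst (sigma j c).
Hypothesis D_X : forall i v, D i (X v) = X (dsvar_shift (inl i) v).
Hypothesis S_X : forall j v, S j (X v) = X (dsvar_shift (inr j) v).
Implicit Types (v w : dsvar m h n) (f g : R) (p q : {poly R}).

(** This is a subring: opposites arise as products with the constant -1. *)
Inductive genby (A : dsvar m h n -> Prop) : R -> Prop :=
  | genby_cst c : genby A (cst c)
  | genby_var w : A w -> genby A (X w)
  | genbyD f g : genby A f -> genby A g -> genby A (f + g)
  | genbyM f g : genby A f -> genby A g -> genby A (f * g).

Local Notation below v := (genby (fun w => dsvar_lt w v)).

Local Notation pbelow v q := (forall i : nat, below v q`_i).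

Lemma genby_sub (A B : dsvar m h n -> Prop) f :
  (forall w, A w -> B w) -> genby A f -> genby B f.
Proof.
move=> AB; elim=> [c|w /AB|{}f g _ IHf _ IHg|{}f g _ IHf _ IHg].
- exact: genby_cst.
- exact: genby_var.
- exact: genbyD.
- exact: genbyM.
Qed.

Lemma below_lt v w f : dsvar_lt v w -> below v f -> below w f.
Proof. by move=> vw; apply: genby_sub => u uv; apply: dsvar_lt_trans vw. Qed.

Lemma below0 v : below v 0.
Proof. by rewrite -(rmorph0 cst); apply: genby_cst. Qed.

Lemma below1 v : below v 1.
Proof. by rewrite -(rmorph1 cst); apply: genby_cst. Qed.

Lemma belowN v f : below v f -> below v (- f).
Proof.
by rewrite -mulN1r -(rmorphN1 cst) => fv; apply: genbyM => //; apply: genby_cst.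
Qed.

Lemma belowB v f g : below v f -> below v g -> below v (f - g).
Proof. by move=> fv gv; apply: genbyD => //; apply: belowN. Qed.

Lemma below_sum v (I : Type) (r : seq I) (F : I -> R) :
  (forall i, below v (F i)) -> below v (\sum_(i <- r) F i).
Proof.
by move=> Fv; elim/big_rec: _ => [|i x _ xv]; [apply: below0|apply: genbyD].
Qed.

Lemma belowMn v f k : below v f -> below v (f *+ k).
Proof.
by move=> fv; elim: k => [|k IH]; rewrite ?mulr0n ?mulrS; [apply: below0|apply: genbyD].
Qed.

Lemma belowXn v f k : below v f -> below v (f ^+ k).
Proof.
by move=> fv; elim: k => [|k IH]; rewrite ?expr0 ?exprS; [apply: below1|apply: genbyM].
Qed.

Lemma pbelow_horner v w q : dsvar_lt v w -> pbelow v q -> below w q.[X v].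
Proof.
move=> vw qv; rewrite horner_coef; apply: below_sum => i; apply: genbyM.
  exact: below_lt (qv i).
by apply: belowXn; apply: genby_var.
Qed.

Lemma pbelowC v f : below v f -> pbelow v f%:P.
Proof. by move=> fv i; rewrite coefC; case: ifP => _ //; apply: below0. Qed.

Lemma pbelowX v : pbelow v 'X.
Proof. by move=> i; rewrite coefX; case: (i == 1)%N; [apply: below1|apply: below0]. Qed.

Lemma pbelowD v p q : pbelow v p -> pbelow v q -> pbelow v (p + q).
Proof. by move=> pv qv i; rewrite coefD; apply: genbyD. Qed.

Lemma pbelowM v p q : pbelow v p -> pbelow v q -> pbelow v (p * q).
Proof. by move=> pv qv i; rewrite coefM; apply: below_sum => j; apply: genbyM. Qed.

Lemma below_delta i v f : below v f -> below (dsvar_shift (inl i) v) (D i f).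
Proof.
have [DD DM] := dsring_derivation dsR i.
(* The Leibniz rule leaves undifferentiated factors, which must also lie below the shifted
   indeterminate. *)
have up x := below_lt (dsvar_lt_shiftr (inl i) v) (f := x).
elim=> [c|w wv|{}f g fv IHf gv IHg|{}f g fv IHf gv IHg].
- by rewrite D_cst; apply: genby_cst.
- by rewrite D_X; apply: genby_var; apply: dsvar_lt_shift.
- by rewrite DD; apply: genbyD.
- by rewrite DM; apply: genbyD; apply: genbyM => //; apply: up.
Qed.

Lemma below_sigma j v f : below v f -> below (dsvar_shift (inr j) v) (S j f).
Proof.
have [SD [_ SM]] := dsring_endomorphism dsR j.
elim=> [c|w wv|{}f g fv IHf gv IHg|{}f g fv IHf gv IHg].
- by rewrite S_cst; apply: genby_cst.
- by rewrite S_X; apply: genby_var; apply: dsvar_lt_shift.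
- by rewrite SD; apply: genbyD.
- by rewrite SM; apply: genbyM.
Qed.

(** The indeterminate [w] plays the role of the leader. When two elements with different leaders are
    combined, the one with the smaller leader becomes a constant polynomial in the larger leader
    ([Qlt]). *)
Lemma genby_poly (A : dsvar m h n -> Prop) f : genby A f ->
  (exists c, f = cst c) \/
  (exists w, A w /\ exists q, pbelow w q /\ f = q.[X w]).
Proof.
pose Q w x := exists q, pbelow w q /\ x = q.[X w].
have Qcst w c : Q w (cst c).
  by exists (cst c)%:P; rewrite hornerC; split=> //; apply/pbelowC/genby_cst.
have Qlt w w' x : dsvar_lt w w' -> Q w x -> Q w' x.
  move=> ww' [q [qw ->]]; exists (q.[X w])%:P; rewrite hornerC; split=> //.
  exact/pbelowC/pbelow_horner.
have op2 (o : R -> R -> R) x y :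
    (forall c d, exists e, o (cst c) (cst d) = cst e) ->
    (forall w a b, Q w a -> Q w b -> Q w (o a b)) ->
    (exists c, x = cst c) \/ (exists w, A w /\ Q w x) ->
    (exists c, y = cst c) \/ (exists w, A w /\ Q w y) ->
    (exists c, o x y = cst c) \/ (exists w, A w /\ Q w (o x y)).
  move=> ocst oQ [[c ->]|[w [Aw wx]]] [[d ->]|[w' [Aw' wy]]].
  - by left; apply: ocst.
  - by right; exists w'; split=> //; apply: oQ.
  - by right; exists w; split=> //; apply: oQ.
  case: (dsvar_lt_total w w') => [ww'|ww'|e].
  - by right; exists w'; split=> //; apply: oQ => //; apply: Qlt wx.
  - by right; exists w; split=> //; apply: oQ => //; apply: Qlt wy.
  - by right; exists w; split=> //; apply: oQ => //; rewrite e.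
elim=> [c|w Aw|{}f g _ IHf _ IHg|{}f g _ IHf _ IHg].
- by left; exists c.
- by right; exists w; split=> //; exists 'X; rewrite hornerX; split=> //; apply: pbelowX.
- apply: op2 IHf IHg => [c d|w a b [p [pw ->]] [q [qw ->]]].
    by exists (c + d); rewrite rmorphD.
  by exists (p + q); rewrite hornerD; split=> //; apply: pbelowD.
- apply: op2 IHf IHg => [c d|w a b [p [pw ->]] [q [qw ->]]].
    by exists (c * d); rewrite rmorphM.
  by exists (p * q); rewrite hornerM; split=> //; apply: pbelowM.
Qed.

(** * Initials, separants and pseudo-division *)

Section Ideals.
Hypothesis char0 : [pchar K] =i pred0.
Context {N : set R}.
Hypothesis pN : prime_dsideal D S N.
Hypothesis N_sigma : forall j f, N (S j f) -> N f.
Implicit Type I : set R.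

Lemma dsideal_cst c : N (cst c) -> cst c = 0.
Proof.
have [->|c0] := eqVneq c 0; first by rewrite rmorph0.
by move/(dsidealM pN (cst c^-1)); rewrite -rmorphM mulVf // rmorph1 => /(dsideal1 pN).
Qed.

Lemma dsidealMn f k : N (f *+ k.+1) -> N f.
Proof.
move/(dsidealM pN (cst k.+1%:R^-1)).
rewrite -[f *+ _]mulr_natl mulrA -(rmorph_nat cst) -rmorphM mulVf ?rmorph1 ?mul1r //.
by rewrite ((pcharf0P _).1 char0).
Qed.

(* A relation of degree k in v over the indeterminates below v, whose initial
   is not in N; sep_shape also keeps its separant out of N. *)
Definition shape I v k := exists q,
  [/\ pbelow v q, (size q <= k.+1)%N, I q.[X v] & ~ N q`_k].

Definition sep_shape I v k := exists q,
  [/\ pbelow v q, (size q <= k.+1)%N, I q.[X v], ~ N q`_k & ~ N q^`().[X v]].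

(** If the separant lies in [N], the derivative of [q] is itself a relation of degree one less, and
    its initial, a positive integer multiple of the old one, stays outside [N] in characteristic
    zero. The descent stops before degree 0, where relation and initial coincide. *)
Lemma shape_sep v k : shape N v k -> exists k', (k' <= k)%N /\ sep_shape N v k'.
Proof.
elim: k => [|k IH] [q [qv qk Nq Nqk]].
  by case: Nqk; move: Nq; rewrite (size1_polyC qk) hornerC coefC eqxx.
have [Ns|nNs] := pselect (N q^`().[X v]); last by exists k.+1; split=> //; exists q.
have [|k' [k'k Sk']] := IH; last by exists k'; split=> //; apply: leqW.
exists q^`(); split=> //.
- by move=> i; rewrite coef_deriv; apply: belowMn.
- by apply/leq_sizeP => i ki; rewrite coef_deriv (leq_sizeP _ _ qk) ?mul0rn.
- by rewrite coef_deriv => /dsidealMn.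
Qed.

(** Multiplication by a power of [X v] raises the degree and keeps the initial; the separant is no
    longer controlled, hence the weaker conclusion. *)
Lemma sep_shape_raise I v k' k : (forall a f, I f -> I (a * f)) ->
  (k' <= k)%N -> sep_shape I v k' -> shape I v k.
Proof.
move=> IM k'k [q [qv qk Iq Nqk _]]; exists ('X^(k - k') * q); split.
- apply: pbelowM => //; elim: (k - k')%N => [|l IH].
    by rewrite expr0; apply/pbelowC/below1.
  by rewrite exprS; apply: pbelowM => //; apply: pbelowX.
- apply: leq_trans (size_polyMleq _ _) _; rewrite size_polyXn addSn /=.
  by apply: leq_trans (leq_add (leqnn _) qk) _; rewrite addnS subnK.
- by rewrite hornerM; apply: IM.
- by rewrite coefXnM ltnNge leq_subr /= subKn.
Qed.

Section Transforms.
Context {I : set R}.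
Hypothesis pI : prime_dsideal D S I.

(** The translation is applied to the coefficients; reflexivity of [N] keeps the new initial and
    separant outside [N]. *)
Lemma sep_shape_sigma j v k :
  sep_shape I v k -> sep_shape I (dsvar_shift (inr j) v) k.
Proof.
move=> [q [qv qk Iq Nqk Nsq]].
have [s sE] := ring_endomorphism_rmorphism (dsring_endomorphism dsR j).
exists (map_poly s q); rewrite -S_X sE; split.
- by move=> i; rewrite coef_map /= -sE; apply: below_sigma.
- exact: leq_trans (size_poly _ _) qk.
- by rewrite horner_map /= -sE; apply: (dsideal_sigma pI).
- by rewrite coef_map /= -sE => /N_sigma.
- by rewrite deriv_map horner_map /= -sE => /N_sigma.
Qed.

(* The derivative of f = q(v) has degree one in the derivative of v, with
   leading coefficient and separant both equal to the separant of f. *)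
Lemma sep_shape_delta i v k :
  sep_shape I v k -> sep_shape I (dsvar_shift (inl i) v) 1.
Proof.
move=> [q [qv qk Iq _ Nsq]]; have vv' := dsvar_lt_shiftr (inl i) v.
exists ((q^`().[X v])%:P * 'X + ((map_poly (D i) q).[X v])%:P); split.
- apply: pbelowD.
    apply: pbelowM (@pbelowX _); apply: pbelowC; apply: pbelow_horner vv' _ => l.
    by rewrite coef_deriv; apply: belowMn.
  apply: pbelowC; rewrite horner_coef; apply: below_sum => l; apply: genbyM.
    by rewrite coef_map_id0 ?(dsring_delta0 dsR) //; exact: below_delta (qv l).
  by apply: belowXn; apply: genby_var.
- by apply/leq_sizeP => -[|[|l]] // _; rewrite coefD coefMX !coefC addr0.
- rewrite !hornerE -D_X addrC -(derivation_horner q (X v) (dsring_derivation dsR i)).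
  exact: (dsideal_delta pI).
- by rewrite coefD coefMX !coefC /= addr0.
- by rewrite derivMXaddC derivC mul0r addr0 hornerC.
Qed.

Lemma sep_shape_gt0 v k : sep_shape I v k -> (0 < k)%N.
Proof.
case: k => // -[q [_ qk _ _ []]].
by rewrite (size1_polyC qk) derivC horner0; apply: (dsideal0 pN).
Qed.

Lemma sep_shape_multiple v w k : w.2 = v.2 -> (forall a, w.1 a <= v.1 a)%N ->
  sep_shape I w k -> exists k', (k' <= k)%N /\ sep_shape I v k'.
Proof.
move=> e2 le Ik.
apply: (dsvar_shift_ind (Q := fun v => exists k', (k' <= k)%N /\ sep_shape I v k')
  _ e2 le); last by exists k.
move=> [i|j] u [k' [k'k Ik']].
  (* A derivation resets the degree to 1, which is at most [k'] because in degree 0 the separant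
     would be 0, an element of [N]. *)
  exists 1%N; split; last exact: sep_shape_delta Ik'.
  exact: leq_trans (sep_shape_gt0 Ik') k'k.
by exists k'; split=> //; apply: sep_shape_sigma.
Qed.

Hypothesis IN : forall f, I f -> N f.
Hypothesis gen : forall f, genby (fun _ => True) f.
Hypothesis shapeNI : forall v k, shape N v k -> shape I v k.

(** Induction on the leader along the ranking, then on the size of the polynomial in that leader. *)
Lemma dsideal_sub_of_shape f : N f -> I f.
Proof.
have cstI c : N (cst c) -> I (cst c).
  by move/dsideal_cst => ->; apply: (dsideal0 pI).
suff polyI w q : pbelow w q -> N q.[X w] -> I q.[X w].
  case: (genby_poly (gen f)) => [[c ->]|[w [_ [q [qw ->]]]]]; first exact: cstI.
  exact: polyI.
elim/(well_founded_ind (@dsvar_lt_wf m h n)): w q => w IHw q.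
have [k] := ubnP (size q); elim: k q => // -[_ q|k IHk q]; rewrite ltnS => qk qw Nq.
  move: qk; rewrite leqn0 size_poly_eq0 => /eqP->.
  by rewrite horner0; apply: (dsideal0 pI).
(* Once the coefficient of degree [k] cancels, the inner induction applies. *)
have drop p : pbelow w p -> (size p <= k.+1)%N -> p`_k = 0 -> N p.[X w] -> I p.[X w].
  move=> pw pk pk0 Np; apply: IHk => //; rewrite ltnS; apply/leq_sizeP => i.
  by rewrite leq_eqVlt => /predU1P[<- //|ki]; apply: (leq_sizeP _ _ pk).
(* An initial in [N] has a smaller leader or is constant, so it is already in [I], and its term can
   be subtracted. *)
have [Nc|nNc] := pselect (N q`_k).
  have Ic : I q`_k.
    case: (genby_poly (qw k)) Nc => [[c ->]|[u [uw [p [pu ->]]]]]; first exact: cstI.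
    exact: IHw.
  have XkC (J : set R) : prime_dsideal D S J -> J q`_k -> J ((q`_k)%:P * 'X^k).[X w].
    by move=> pJ; rewrite hornerM hornerC mulrC; apply: (dsidealM pJ).
  rewrite -[q](subrK ((q`_k)%:P * 'X^k)) hornerD; apply: (dsidealD pI); last exact: XkC.
  apply: drop.
  - move=> i; rewrite coefB coefCM coefXn; apply: belowB => //.
    by apply: genbyM => //; case: eqP => _; [apply: below1|apply: below0].
  - apply/leq_sizeP => i ki; rewrite coefB coefCM coefXn (leq_sizeP _ _ qk _ ki).
    by rewrite gtn_eqF // mulr0 subr0.
  - by rewrite coefB coefCM coefXn eqxx mulr1 subrr.
  - by rewrite hornerD hornerN; apply: (dsidealB pN) => //; apply: XkC.
(* Otherwise [I] has a relation [p] of the same degree, and cross-multiplying by the initials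
   cancels degree [k]. Primality of [I] then removes the factor [p_k], which is not in [I] as it is
   not in [N]. *)
have [|p [pw pk Ip nNp]] := @shapeNI w k; first by exists q.
have : I ((p`_k)%:P * q - (q`_k)%:P * p).[X w].
  apply: drop.
  - by move=> i; rewrite coefB !coefCM; apply: belowB; apply: genbyM.
  - apply/leq_sizeP => i ki; rewrite coefB !coefCM.
    by rewrite (leq_sizeP _ _ qk _ ki) (leq_sizeP _ _ pk _ ki) !mulr0 subr0.
  - by rewrite coefB !coefCM mulrC subrr.
  - rewrite hornerD hornerN !hornerM !hornerC.
    apply: (dsidealB pN); apply: (dsidealM pN) => //.
    exact: IN.
rewrite hornerD hornerN !hornerM !hornerC => Ipq.
have /(dsideal_prime_or pI)[/IN|//] : I (p`_k * q.[X w]).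
  rewrite -[_ * _](subrK (q`_k * p.[X w])).
  by apply: (dsidealD pI) => //; apply: (dsidealM pI).
by move/nNp.
Qed.

End Transforms.
End Ideals.

(** * Finitely many relations determine the reflexive closure *)

Lemma sep_shape_list N (F : seq (dsvar m h n * nat)) :
  List.Forall (fun s => sep_shape (N := N) N s.1 s.2) F ->
  exists G : seq R, List.Forall N G /\ forall I, List.Forall I G ->
    List.Forall (fun s => sep_shape (N := N) I s.1 s.2) F.
Proof.
elim: F => [|[v k] F IH] FN; first by exists [::].
have [[q [qv qk Nq Nqk Nsq]] {}/IH [G [NG GF]]] := (List.Forall_cons_iff _ _ _).1 FN.
exists (q.[X v] :: G); split; first by constructor.
move=> I /List.Forall_cons_iff [Iq /GF IF]; constructor=> //.
by exists q.
Qed.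

Theorem reflexive_closure_preimage (P : set R) : [pchar K] =i pred0 ->
  (forall f, genby (fun _ => True) f) -> prime_dsideal D S P ->
  exists g : Gamma h, reflexive_closure S P = Gamma_act S g @^-1` P.
Proof.
move=> char0 gen pP; set N := reflexive_closure S P.
have pN : prime_dsideal D S N := reflexive_closure_prime_dsideal dsR pP.
have N_sigma j f : N (S j f) -> N f := @reflexive_closure_sigma _ _ _ _ _ dsR P j f.
(* The last coordinate turns the order comparison of the indices of the
   indeterminates into their equality. *)
pose coord (i : option ('I_m + 'I_h) + bool) (p : dsvar m h n * nat) : nat :=
  match i with
  | inl i => dsvar_coord i p.1
  | inr b => if b then p.2 else (n - p.1.2)%N
  end.
have [F [FN Fle]] := dickson coord (fun s => sep_shape (N := N) N s.1 s.2).
(* The ideal [I] enters [sep_shape] only through the value of the relation, so finitely many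
   elements [G] carry all the pairs in [F]. *)
have [G [NG GF]] := sep_shape_list FN.
have [g gG] := reflexive_closure_finite dsR pP NG.
have pI : prime_dsideal D S (Gamma_act S g @^-1` P) := preimage_prime_dsideal dsR pP g.
have IN f : (Gamma_act S g @^-1` P) f -> N f by exists g.
exists g; apply/seteqP; split=> f; last exact: IN.
apply: (dsideal_sub_of_shape pN pI IN gen) => v k /(shape_sep char0 pN) [k' [k'k Nk']].
(* The pair [(w, l)] below [(v, k')] is first moved to [v] by operators, without raising its degree,
   and then lifted to degree [k]. *)
have /List.Exists_exists [[w l] [wF le]] := Fle (v, k') Nk'.
have Iw := (List.Forall_forall _ _).1 (GF _ gG) _ wF.
have e2 : w.2 = v.2.
  apply: val_inj; apply/eqP; rewrite eqn_leq (le (inl None)) /=.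
  have := le (inr false); rewrite /= leq_sub2lE //; exact: ltnW.
have [l' [l'l Il']] :=
  sep_shape_multiple pN N_sigma pI e2 (fun a => le (inl (Some a))) Iw.
apply: sep_shape_raise Il' => [a x|]; first exact: (dsidealM pI).
by apply: leq_trans l'l _; apply: leq_trans (le (inr true)) k'k.
Qed.

End Generated.

(** * Specialization to difference-differential polynomials *)

Lemma dspoly_genby (K : fieldType) (m h n : nat) (p : dspoly K m h n) :
  genby (@malgC _ K) (fun v => << ucm v >>) (fun _ => True) p.
Proof.
move: p; apply: dspoly_ind => [c|v|f g|f g].
- exact: genby_cst.
- exact: genby_var.
- exact: genbyD.
- exact: genbyM.
Qed.

Theorem mainTheorem3 (K : fieldType) (char0 : [pchar K] =i pred0)
    (m h n : nat) (delta : 'I_m -> K -> K) (sigma : 'I_h -> K -> K)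
    (dsK : is_dsring delta sigma)
    (P : set (dspoly K m h n))
    (primeP : prime_dsideal (dspoly_delta delta) (dspoly_sigma sigma) P) :
  exists g : Gamma h,
    reflexive_closure (dspoly_sigma sigma) P =
    Gamma_act (dspoly_sigma sigma) g @^-1` P.
Proof.
exact: (reflexive_closure_preimage (dspoly_is_dsring dsK)
  (dspoly_deltaC dsK) (dspoly_sigmaC dsK) (dspoly_delta_var dsK) (dspoly_sigma_var dsK)
  char0 (@dspoly_genby K m h n) primeP).
Qed.
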